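(* Let $R$ be a ring, $G$ a finite group acting on $R$, and $H$ a subgroup of $G$. Then $\mathrm{cfD}(RH)\le \mathrm{cfD}(RG)$, and equality holds when $RG$ is a separable extension over $RH$.
   Context: Rings are associative with identity; modules are unitary and are left modules unless otherwise specified. $G$ acts on $R$ by ring automorphisms: $r\mapsto g(r)$ is a ring automorphism for each $g\in G$, $(g_1g_2)(r)=g_1(g_2(r))$ and $1(r)=r$. The skew group ring $RG$ is the free left $R$-module with basis $G$ and multiplication $(ag)(bh)=a\,g(b)\,gh$ for $a,b\in R$, $g,h\in G$. For a subgroup $H\le G$ (with the restricted action), $RH$ is a subring of $RG$. A ring $A$ is a separable extension over a subring $S$ if the multiplication map $A\otimes_S A\to A$, $a\otimes b\mapsto ab$, splits as a map of $A$-$A$-bimodules; i.e. there is $\sum_i a_i\otimes b_i\in A\otimes_S A$ with $\sum_i a_i\otimes b_i a=\sum_i a a_i\otimes b_i$ for all $a\in A$ and $\sum_i a_ib_i=1$. The copure flat dimension $\mathrm{cfd}_A(M)$ of an $A$-module $M$ is the smallest integer $n\ge0$ such that $\operatorname{Tor}^A_{n+i}(E,M)=0$ for every injective right $A$-module $E$ and every integer $i\ge1$ ($\infty$ if no such $n$ exists). The copure flat dimension $\mathrm{cfD}(A)$ of the ring $A$ is the supremum of $\mathrm{cfd}_A(M)$ over all $A$-modules $M$. *)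

(* Defs.v *)
From HB Require Import structures.
From mathcomp Require Import all_fingroup.
From mathcomp Require Import all_boot all_order all_algebra.
From mathcomp Require Import boolp classical_sets functions.
From mathcomp Require Import constructive_ereal freeg.

Set Implicit Arguments.
Unset Strict Implicit.
Unset Printing Implicit Defensive.

Import Order.TTheory GRing.Theory Num.Theory.
Local Open Scope ring_scope.
Local Open Scope quotient_scope.

(* Rings are [pzRingType]s (associative, with 1, not necessarily commutative);
   left A-modules are [lmodType A], right A-modules are [lmodType A^c]: the
   element [e a] of a right module is written [(a : A^c) *: e]. *)

Lemma zmod_morphD (U V : zmodType) (f : U -> V) :
  zmod_morphism f -> {morph f : x y / x + y}.
Proof.
move=> fB x y; have f0 : f 0 = 0 by rewrite -[X in f X](subrr 0) fB subrr.
have fN z : f (- z) = - f z by rewrite -[X in f X]sub0r fB f0 sub0r.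
by rewrite -[y in LHS]opprK fB fN opprK.
Qed.

Lemma freeg_zind (K : choiceType) (P : {freeg K / int} -> Prop) :
  P 0 -> (forall k, P << k >>) -> (forall u v, P u -> P v -> P (u - v)) ->
  forall u, P u.
Proof.
move=> P0 Pk PB u.
have PN v : P v -> P (- v) by move=> Pv; rewrite -sub0r; apply: PB.
have PD v w : P v -> P w -> P (v + w).
  by move=> Pv Pw; rewrite -[w]opprK; apply: PB => //; apply: PN.
rewrite -[u]freeg_sumE; elim/big_ind: _ => // k _; set c := coeff _ _.
have Pn n : P << n%:Z *g k >>.
  rewrite -[n%:Z]natz -freegU_muln.
  by elim: n => [|n IHn]; [exact: P0|rewrite mulrS; exact: PD].
by case: c => n; [exact: Pn|rewrite NegzE -freegUN; apply/PN/Pn].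
Qed.

Record ring_action (gT : finGroupType) (R : pzRingType) := RingAction {
  ract :> gT -> {rmorphism R -> R};
  ract1 : forall r, ract 1%g r = r;
  ractM : forall g1 g2 r, ract (g1 * g2)%g r = ract g1 (ract g2 r) }.

(* A function x stands for the formal sum \sum_g (x g) g. This is an alias of
   {ffun gT -> R} with the same addition, but not the pointwise product. *)
Definition skew_group_ring (gT : finGroupType) (R : pzRingType)
  (act : ring_action gT R) : Type := {ffun gT -> R}.

Section SkewGroupRing.
Variables (gT : finGroupType) (R : pzRingType) (act : ring_action gT R).
Local Notation RG := (skew_group_ring act).

HB.instance Definition _ := GRing.Zmodule.on RG.

Definition skew_term (a : R) (g : gT) : RG :=
  [ffun k => if k == g then a else 0].

(* The coefficient at k of (\sum_g x_g g) (\sum_h y_h h)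
   = \sum_(g, h) x_g g(y_h) gh: the pairs with gh = k have h = g^-1 k. *)
Definition skew_mul (x y : RG) : RG :=
  [ffun k => \sum_g (x : {ffun gT -> R}) g *
               act g ((y : {ffun gT -> R}) (g^-1 * k)%g)].

Definition skew_one : RG := skew_term 1 1%g.

Let skew_mulA : associative skew_mul.
Proof.
move=> x y z; apply/ffunP => k; rewrite !ffunE.
under eq_bigr => g _ do rewrite ffunE rmorph_sum mulr_sumr.
under [RHS]eq_bigr => g _ do rewrite ffunE mulr_suml.
rewrite [RHS]exchange_big /=; apply: eq_bigr => g _.
rewrite [RHS](reindex_inj (mulgI g)) /=; apply: eq_bigr => h _.
by rewrite mulKg rmorphM -ractM mulrA invMg mulgA.
Qed.

Let skew_mul1x : left_id skew_one skew_mul.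
Proof.
move=> x; apply/ffunP => k; rewrite !ffunE (bigD1 1%g) //= big1 => [|g /negPf g1].
  by rewrite ffunE eqxx mul1r ract1 invg1 mul1g addr0.
by rewrite ffunE g1 mul0r.
Qed.

Let skew_mulx1 : right_id skew_one skew_mul.
Proof.
move=> x; apply/ffunP => k; rewrite !ffunE (bigD1 k) //= big1 => [|g /negPf gk].
  by rewrite ffunE mulVg eqxx rmorph1 mulr1 addr0.
by rewrite ffunE -(inj_eq (mulgI g)) mulKVg mulg1 eq_sym gk rmorph0 mulr0.
Qed.

Let skew_mulDl : left_distributive skew_mul +%R.
Proof.
move=> x y z; apply/ffunP => k; rewrite !ffunE -big_split /=.
by apply: eq_bigr => g _; rewrite ffunE mulrDl.
Qed.

Let skew_mulDr : right_distributive skew_mul +%R.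
Proof.
move=> x y z; apply/ffunP => k; rewrite !ffunE -big_split /=.
by apply: eq_bigr => g _; rewrite ffunE rmorphD mulrDr.
Qed.

HB.instance Definition _ := GRing.Zmodule_isPzRing.Build RG
  skew_mulA skew_mul1x skew_mulx1 skew_mulDl skew_mulDr.

Lemma skew1E (k : gT) : (1 : RG) k = if k == 1%g then 1 else 0.
Proof. exact: ffunE. Qed.

Lemma skew_mulE (x y : RG) (k : gT) :
  (x * y : RG) k = \sum_g x g * act g (y (g^-1 * k)%g).
Proof. exact: ffunE. Qed.

Lemma skew_sumE (x : RG) : x = \sum_g skew_term (x g) g.
Proof.
apply/ffunP => k; rewrite sum_ffunE (bigD1 k) //= ffunE eqxx big1 ?addr0 //.
by move=> g /negPf gk; rewrite ffunE eq_sym gk.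
Qed.

Lemma skew_termM (a b : R) (g h : gT) :
  skew_term a g * skew_term b h = skew_term (a * act g b) (g * h)%g :> RG.
Proof.
apply/ffunP => k; rewrite skew_mulE (bigD1 g) //= !ffunE eqxx big1 => [|i /negPf ig].
  rewrite addr0 -(inj_eq (mulgI g)) mulKVg.
  by case: ifP => // _; rewrite rmorph0 mulr0.
by rewrite ffunE ig mul0r.
Qed.

End SkewGroupRing.

Section SkewSubgroupRing.
Variables (gT : finGroupType) (R : pzRingType) (act : ring_action gT R).
Variable H : {group gT}.

Definition restrict_action : ring_action (subg_of H) R :=
  @RingAction (subg_of H) R (fun h => act (sgval h))
    (ract1 act) (fun h1 h2 => ractM act (sgval h1) (sgval h2)).

Local Notation RH := (skew_group_ring restrict_action).
Local Notation RG := (skew_group_ring act).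

Definition skew_incl (x : RH) : RG :=
  [ffun g => if g \in H then (x : {ffun subg_of H -> R}) (subg H g) else 0].

Let skew_incl_is_additive : zmod_morphism skew_incl.
Proof.
move=> x y; apply/ffunP => g; rewrite !ffunE; case: ifP => _ //.
by rewrite subr0.
Qed.

Let skew_incl_is_monoid : monoid_morphism skew_incl.
Proof.
split=> [|x y]; apply/ffunP => k.
  rewrite ffunE !skew1E; case: ifP => [kH|/negbT kH].
    by rewrite -(inj_eq val_inj) /= subgK.
  by case: eqP kH => // ->; rewrite group1.
rewrite skew_mulE ffunE; case: ifP => [kH|/negbT kH]; last first.
  rewrite big1 // => g _; rewrite !ffunE; case: ifP => [gH|_]; last by rewrite mul0r.
  by rewrite groupMl ?groupV // (negPf kH) rmorph0 mulr0.
rewrite skew_mulE [RHS](bigID (mem H)) /= [X in _ + X]big1 ?addr0; last first.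
  by move=> g /negPf gH; rewrite ffunE gH mul0r.
rewrite [RHS](reindex_onto sgval (subg H)) /=; last by move=> g gH; rewrite subgK.
apply: eq_big => [h|h _]; first by rewrite sgvalK eqxx (subgP h).
rewrite !ffunE (subgP h) groupMl ?groupV ?(subgP h) // kH sgvalK.
congr (_ * act _ (y _)).
by apply: val_inj; rewrite /= !subgK ?groupM ?groupV ?(subgP h).
Qed.

HB.instance Definition _ :=
  GRing.isZmodMorphism.Build RH RG skew_incl skew_incl_is_additive.
HB.instance Definition _ :=
  GRing.isMonoidMorphism.Build RH RG skew_incl skew_incl_is_monoid.

Lemma skew_incl_inj : injective skew_incl.
Proof.
move=> x y /ffunP exy; apply/ffunP => h.
by have := exy (sgval h); rewrite !ffunE (subgP h) sgvalK.
Qed.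

End SkewSubgroupRing.

(* The tensor product of a right and a left S-module with underlying groups E
   and M and actions ra, la, as the quotient of the free abelian group on E * M
   by the subgroup generated by the usual relators. The actions are explicit
   parameters, so that it applies to modules by restriction as well. *)
Section Tensor.
Variables (S : Type) (E M : zmodType) (ra : E -> S -> E) (la : S -> M -> M).

Definition fgen (e : E) (m : M) : {freeg (E * M) / int} := << (e, m) >>.

Inductive tensor_relator : {freeg (E * M) / int} -> Prop :=
| Relator0 : tensor_relator 0
| RelatorB u v :
    tensor_relator u -> tensor_relator v -> tensor_relator (u - v)
| RelatorDl e e' m : tensor_relator (fgen (e + e') m - (fgen e m + fgen e' m))
| RelatorDr e m m' : tensor_relator (fgen e (m + m') - (fgen e m + fgen e m'))
| RelatorA e s m : tensor_relator (fgen (ra e s) m - fgen e (la s m)).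

Definition tensor_relators : {pred {freeg (E * M) / int}} :=
  fun u => `[< tensor_relator u >].

Let tensor_relators_closed : zmod_closed tensor_relators.
Proof.
split=> [|u v]; first exact/asboolP/Relator0.
by move=> /asboolP ru /asboolP rv; apply/asboolP/RelatorB.
Qed.

HB.instance Definition _ :=
  GRing.isZmodClosed.Build _ tensor_relators tensor_relators_closed.

Definition tensor : Type := {ideal_quot tensor_relators}.
HB.instance Definition _ := GRing.Zmodule.on tensor.

Definition tens (e : E) (m : M) : tensor := \pi_{ideal_quot tensor_relators} (fgen e m).

Definition balanced (V : zmodType) (b : E -> M -> V) : Prop :=
  [/\ forall e e' m, b (e + e') m = b e m + b e' m,
      forall e m m', b e (m + m') = b e m + b e m'
    & forall e s m, b (ra e s) m = b e (la s m)].

(* The homomorphism with e ⊗ m |-> b e m, computed on a representative; it is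
   meaningful only for balanced b. *)
Definition tensor_lift (V : zmodType) (b : E -> M -> V) (t : tensor) : V :=
  let u : {freeg (E * M) / int} := repr (t : {ideal_quot tensor_relators}) in
  \sum_(em <- dom u) b em.1 em.2 *~ coeff em u.

Let eq_pi (u v : {freeg (E * M) / int}) :
  tensor_relator (u - v) ->
  \pi_{ideal_quot tensor_relators} u = \pi_{ideal_quot tensor_relators} v.
Proof.
by move=> r; apply/eqP; rewrite -Quotient.idealrBE; apply/asboolP.
Qed.

Lemma tens_balanced : balanced tens.
Proof.
by split=> *; rewrite /tens -?raddfD; apply: eq_pi; constructor.
Qed.

Lemma tensor_ind (P : tensor -> Prop) :
  (forall e m, P (tens e m)) -> (forall t u, P t -> P u -> P (t - u)) ->
  forall t, P t.
Proof.
move=> Pt PB t.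
have P0 : P 0 by rewrite -(subrr (tens 0 0)); apply: PB.
have -> : t = \pi_{ideal_quot tensor_relators}
                (repr (t : {ideal_quot tensor_relators})) by rewrite reprK.
elim/freeg_zind: (repr _) => [|[e m]|u v Pu Pv].
- by rewrite raddf0; apply: P0.
- exact: Pt.
- by rewrite raddfB; apply: PB.
Qed.

Section Lift.
Variables (V : zmodType) (b : E -> M -> V).
Hypothesis b_bal : balanced b.

Let bf : E * M -> zmodule V := fun em => b em.1 em.2.

Let bfB u v : fglift bf (u - v) = fglift bf u - fglift bf v.
Proof. exact: lift_is_additive. Qed.

Let bfD u v : fglift bf (u + v) = fglift bf u + fglift bf v.
Proof. exact: zmod_morphD. Qed.

Let bfU e m : fglift bf (fgen e m) = b e m.
Proof. by rewrite /fgen liftU scale1r. Qed.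

Let bfE u : \sum_(em <- dom u) b em.1 em.2 *~ coeff em u = fglift bf u.
Proof.
have bf0 : fglift bf 0 = 0 by rewrite -(subrr 0) bfB subrr.
rewrite -[in RHS](freeg_sumE u) (big_morph _ bfD bf0).
by apply: eq_bigr => em _; rewrite liftU scalezrE.
Qed.

Let bf_relator u : tensor_relator u -> fglift bf u = 0.
Proof.
case: b_bal => bDl bDr bA; elim=> [|{}u v _ u0 _ v0|e e' m|e m m'|e s m].
- by rewrite -(subrr 0) bfB subrr.
- by rewrite bfB u0 v0 subrr.
- by rewrite bfB bfD !bfU bDl subrr.
- by rewrite bfB bfD !bfU bDr subrr.
- by rewrite bfB !bfU bA subrr.
Qed.

Let liftE u : tensor_lift b (\pi_{ideal_quot tensor_relators} u) = fglift bf u.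
Proof.
rewrite /tensor_lift bfE; apply/eqP; rewrite -subr_eq0 -bfB; apply/eqP/bf_relator.
have : repr (\pi_{ideal_quot tensor_relators} u) - u \in tensor_relators.
  by rewrite Quotient.idealrBE reprK.
by move/asboolP.
Qed.

Lemma tensor_lift_is_additive : zmod_morphism (tensor_lift b).
Proof.
elim/quotW=> u; elim/quotW=> v.
by rewrite -[_ - _](raddfB \pi_{ideal_quot tensor_relators}) !liftE bfB.
Qed.

Lemma tensor_lift_tens e m : tensor_lift b (tens e m) = b e m.
Proof. by rewrite liftE bfU. Qed.

End Lift.
End Tensor.

Section Modules.
Variable A : pzRingType.

Definition mod_tensor (E : lmodType A^c) (M : lmodType A) : zmodType :=
  tensor (fun (e : E) (a : A) => (a : A^c) *: e) (fun (a : A) (m : M) => a *: m).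

Section IdTensor.
Variables (E : lmodType A^c) (M N : lmodType A) (f : {linear M -> N}).

Definition id_tensor : mod_tensor E M -> mod_tensor E N :=
  tensor_lift (fun e m => tens _ _ e (f m)).

Let id_tensor_balanced :
  balanced (fun (e : E) (a : A) => (a : A^c) *: e) (fun (a : A) (m : M) => a *: m)
    (fun e m => tens _ _ e (f m) : mod_tensor E N).
Proof.
have [bDl bDr bA] := tens_balanced (fun (e : E) (a : A) => (a : A^c) *: e)
                                   (fun (a : A) (m : N) => a *: m).
split=> [e e' m|e m m'|e a m]; first exact: bDl.
  by rewrite raddfD; apply: bDr.
by rewrite linearZ; apply: bA.
Qed.

Let id_tensor_is_additive : zmod_morphism id_tensor.
Proof. exact: (tensor_lift_is_additive id_tensor_balanced). Qed.

HB.instance Definition _ := GRing.isZmodMorphism.Build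
  (mod_tensor E M) (mod_tensor E N) id_tensor id_tensor_is_additive.

Lemma id_tensorE e m : id_tensor (tens _ _ e m) = tens _ _ e (f m).
Proof. exact: (tensor_lift_tens id_tensor_balanced). Qed.

End IdTensor.

Definition injective_module (E : lmodType A) : Prop :=
  forall (X Y : lmodType A) (i : {linear X -> Y}) (f : {linear X -> E}),
    injective i -> exists g : {linear Y -> E}, forall x, g (i x) = f x.

Definition projective_module (P : lmodType A) : Prop :=
  forall (X Y : lmodType A) (p : {linear X -> Y}) (f : {linear P -> Y}),
    (forall y, exists x, p x = y) ->
    exists g : {linear P -> X}, forall x, p (g x) = f x.

Record projective_resolution (M : lmodType A) := ProjectiveResolution {
  res_mod : nat -> lmodType A;
  res_diff : forall n, {linear res_mod n.+1 -> res_mod n};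
  res_aug : {linear res_mod 0 -> M};
  res_projective : forall n, projective_module (res_mod n);
  res_aug_surj : forall x, exists y, res_aug y = x;
  res_exact0 : forall x, res_aug x = 0 <-> exists y, res_diff 0 y = x;
  res_exactS : forall n x,
    res_diff n x = 0 <-> exists y, res_diff n.+1 y = x }.

Definition tensor_homology_eq0 (E : lmodType A^c) (M : lmodType A)
    (P : projective_resolution M) (n : nat) : Prop :=
  if n is k.+1 then
    forall t : mod_tensor E (res_mod P k.+1),
      id_tensor (res_diff P k) t = 0 ->
      exists u, id_tensor (res_diff P k.+1) u = t
  else forall t : mod_tensor E (res_mod P 0),
    exists u, id_tensor (res_diff P 0) u = t.

(* Tor_n^A(E, M) = 0. The choice of the projective resolution P is irrelevant,
   and one always exists (see [projective_resolution_exists] below). *)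
Definition Tor_eq0 (n : nat) (E : lmodType A^c) (M : lmodType A) : Prop :=
  forall P : projective_resolution M, tensor_homology_eq0 E P n.

End Modules.

Section CopureFlatDimension.
Variable A : pzRingType.

Definition cfd_le (M : lmodType A) (n : nat) : Prop :=
  forall E : lmodType A^c, injective_module E ->
  forall i : nat, (1 <= i)%N -> Tor_eq0 (n + i) E M.

Definition cfd (M : lmodType A) : \bar int :=
  if pselect (exists n, `[< cfd_le M n >]) is left cfd_fin
  then ((ex_minn cfd_fin)%:Z)%:E else +oo%E.

Definition cfD : \bar int :=
  supremum (0%E : \bar int) [set d | exists M : lmodType A, d = cfd M]%classic.

Lemma cfd_nat (M : lmodType A) :
  cfd M = +oo%E \/ exists n : nat, cfd M = (n%:Z)%:E.
Proof. by rewrite /cfd; case: pselect => [h|_]; [right; eexists|left]. Qed.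

(* The supremum defining [cfD] exists. *)
Lemma cfD_supremum :
  supremums [set d | exists M : lmodType A, d = cfd M]%classic cfD.
Proof.
rewrite /cfD; set D := mkset _.
have D0 : (D !=set0)%classic by exists (cfd (A^o : lmodType A)); exists (A^o : lmodType A).
suff : exists d, supremums D d.
  move=> [d dD]; rewrite /supremum; case: ifPn => [/eqP D0'|_].
    by case: D0 => x; rewrite D0'.
  by apply: xgetPex; exists d.
have [[n nub]|nub] := pselect (exists n : nat, ubound D (n%:Z)%:E); last first.
  exists +oo%E; split=> [x _|u uD]; first exact: leey.
  case: u uD => [z zD||noo] //.
    case: nub; exists `|z|%N => x /zD /le_trans; apply.
    by rewrite lee_fin abszE ler_norm.
  case: nub; exists 0%N => x /noo /le_trans; apply; exact: leNye.
have exP : exists n, `[< ubound D (n%:Z)%:E >] by exists n; apply/asboolP.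
case: (ex_minnP exP) => m /asboolP mub mmin; exists (m%:Z)%:E; split=> // u uD.
have [M0 _] : exists M : lmodType A, True by exists (A^o : lmodType A).
have cu (M : lmodType A) : (cfd M <= u)%E by apply: uD; exists M.
case: u uD cu => [z zD cu|_ _|_ cu]; last 2 first.
- exact: leey.
- by have := cu M0; case: (cfd_nat M0) => [->|[k ->]].
have z0 : 0 <= z.
  have := cu M0; case: (cfd_nat M0) => [->|[k ->]] //.
  by rewrite lee_fin; apply: le_trans.
rewrite lee_fin -(gez0_abs z0) lez_nat; apply: mmin; apply/asboolP.
by rewrite gez0_abs.
Qed.

End CopureFlatDimension.

Section Separable.
Variables (S A : pzRingType) (f : {rmorphism S -> A}).

Definition ext_tensor : zmodType :=
  tensor (fun (a : A) (s : S) => a * f s) (fun (s : S) (b : A) => f s * b).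

Definition separable_extension : Prop :=
  exists ab : seq (A * A),
    (forall a : A, \sum_(p <- ab) (tens _ _ p.1 (p.2 * a) : ext_tensor) =
                   \sum_(p <- ab) (tens _ _ (a * p.1) p.2 : ext_tensor)) /\
    \sum_(p <- ab) p.1 * p.2 = 1.

End Separable.

Section FreeModule.
Variables (A : pzRingType) (K : choiceType).

(* A ⊗_ℤ ℤ[K]; there are no scalars to balance, hence the type [void]. *)
Definition free_module : Type :=
  tensor (fun (a : A) (v : void) => a)
         (fun (v : void) (u : {freeg K / int}) => u).
HB.instance Definition _ := GRing.Zmodule.on free_module.

Definition free_tens (a : A) (u : {freeg K / int}) : free_module := tens _ _ a u.
Definition free_scale (a : A) : free_module -> free_module :=
  tensor_lift (fun b u => free_tens (a * b) u).

Let tDl a b u : free_tens (a + b) u = free_tens a u + free_tens b u.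
Proof. by have [+ _ _] := tens_balanced (fun (a : A) (v : void) => a)
         (fun (v : void) (u : {freeg K / int}) => u); apply. Qed.
Let tDr a u v : free_tens a (u + v) = free_tens a u + free_tens a v.
Proof. by have [_ + _] := tens_balanced (fun (a : A) (v : void) => a)
         (fun (v : void) (u : {freeg K / int}) => u); apply. Qed.

Let scale_bal a : balanced (fun (a : A) (v : void) => a)
  (fun (v : void) (u : {freeg K / int}) => u) (fun b u => free_tens (a * b) u).
Proof. by split=> [b b' u|b u v|b []] //=; rewrite mulrDr tDl. Qed.

Let scaleB a : zmod_morphism (free_scale a).
Proof. exact/tensor_lift_is_additive/scale_bal. Qed.

Let scaleE a b u : free_scale a (free_tens b u) = free_tens (a * b) u.
Proof. exact/tensor_lift_tens/scale_bal. Qed.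

Let scaleA a b t : free_scale a (free_scale b t) = free_scale (a * b) t.
Proof.
elim/tensor_ind: t => [c u|t u]; first by rewrite !scaleE mulrA.
by rewrite !scaleB => -> ->.
Qed.

Let scale1 : left_id 1 free_scale.
Proof.
elim/tensor_ind=> [c u|t u]; first by rewrite scaleE mul1r.
by rewrite scaleB => -> ->.
Qed.

Let scaleDr : right_distributive free_scale +%R.
Proof.
by move=> a x y; apply: zmod_morphD.
Qed.

Let scaleDl t : {morph free_scale^~ t : a b / a + b}.
Proof.
move=> a b /=; elim/tensor_ind: t => [c u|t u]; first by rewrite !scaleE mulrDl tDl.
by rewrite !scaleB => -> ->; rewrite opprD addrACA.
Qed.

HB.instance Definition _ := GRing.Zmodule_isLmodule.Build A free_module
  scaleA scale1 scaleDr scaleDl.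

Let free_ind_tens (P : free_module -> Prop) :
  (forall a u, P (free_tens a u)) -> (forall t u, P t -> P u -> P (t - u)) ->
  forall t, P t.
Proof. exact: tensor_ind. Qed.

Lemma free_ind (P : free_module -> Prop) :
  P 0 -> (forall k, P (free_tens 1 << k >>)) ->
  (forall a t, P t -> P (a *: t)) -> (forall t u, P t -> P u -> P (t - u)) ->
  forall t, P t.
Proof.
move=> P0 Pk PZ PB; elim/free_ind_tens=> // a.
have tB u v : free_tens a (u - v) = free_tens a u - free_tens a v.
  by apply/eqP; rewrite eq_sym subr_eq -tDr subrK.
elim/freeg_zind=> [|k|u v Pu Pv].
- by rewrite -(subrr 0) tB subrr.
- by rewrite -[a in free_tens a _]mulr1 -scaleE; apply: PZ.
- by rewrite tB; apply: PB.
Qed.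

Section Lift.
Variables (N : lmodType A) (h : K -> N).

Let hl : {freeg K / int} -> zmodule N := fglift (h : K -> zmodule N).

Definition free_lift : free_module -> N :=
  tensor_lift (fun a u => a *: (hl u : N)).

Let hlD u v : hl (u + v) = hl u + hl v.
Proof. by apply: zmod_morphD => x y; apply: lift_is_additive. Qed.

Let lift_bal : balanced (fun (a : A) (v : void) => a)
  (fun (v : void) (u : {freeg K / int}) => u) (fun a u => a *: (hl u : N)).
Proof. by split=> [a b u|a u v|a []]; rewrite ?hlD ?scalerDl ?scalerDr. Qed.

Let free_liftE a u : free_lift (free_tens a u) = a *: (hl u : N).
Proof. exact: (tensor_lift_tens lift_bal). Qed.

Let free_lift_additive : zmod_morphism free_lift.
Proof. exact: (tensor_lift_is_additive lift_bal). Qed.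

HB.instance Definition _ := GRing.isZmodMorphism.Build free_module N
  free_lift free_lift_additive.

Let free_lift_scalable : scalable free_lift.
Proof.
move=> a; elim/free_ind_tens=> [b u|t u tE uE].
  by rewrite [_ *: _]scaleE !free_liftE scalerA.
  by rewrite !raddfB /= tE uE.
Qed.

HB.instance Definition _ := GRing.isScalable.Build A free_module N _
  free_lift free_lift_scalable.

Lemma free_lift_gen k : free_lift (free_tens 1 << k >>) = h k.
Proof. by rewrite free_liftE scale1r /hl liftU scale1r. Qed.

End Lift.
End FreeModule.

Section Existence.
Variable A : pzRingType.

Lemma free_module_projective (K : choiceType) :
  projective_module (free_module A K).
Proof.
move=> X Y p f p_surj.
have /boolp.choice[h hE] (k : K) : exists x, p x = f (free_tens 1 << k >>).
  exact: p_surj.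
exists (free_lift h); elim/free_ind => [|k|a t IH|t u IHt IHu].
- by rewrite !raddf0.
- by rewrite /= free_lift_gen hE.
- by rewrite !linearZ /= IH.
- by rewrite !raddfB /= IHt IHu.
Qed.

Section Kernel.
Variables (M N : lmodType A) (f : {linear M -> N}).

Definition lker_pred : {pred M} := fun x => f x == 0.

Let lker_submod : submod_closed lker_pred.
Proof.
split=> [|a x y]; rewrite !unfold_in /lker_pred ?raddf0 //.
by move=> /eqP fx /eqP fy; rewrite linearP fx fy scaler0 addr0.
Qed.
HB.instance Definition _ := GRing.isSubmodClosed.Build A M lker_pred lker_submod.

Definition lker : Type := {x : M | x \in lker_pred}.
HB.instance Definition _ := [isSub of lker for sval].
HB.instance Definition _ := [Choice of lker by <:].
HB.instance Definition _ := [SubChoice_isSubLmodule of lker by <:].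

Definition lker_val (x : lker) : M := val x.
Let lker_val_additive : zmod_morphism lker_val. Proof. by []. Qed.
Let lker_val_scalable : scalable lker_val. Proof. by []. Qed.
HB.instance Definition _ :=
  GRing.isZmodMorphism.Build lker M lker_val lker_val_additive.
HB.instance Definition _ :=
  GRing.isScalable.Build A lker M _ lker_val lker_val_scalable.

End Kernel.

Definition free_cover (M : lmodType A) : {linear free_module A M -> M} :=
  free_lift (fun x : M => x).

Fixpoint syzygy (M : lmodType A) (n : nat) : lmodType A :=
  if n is k.+1 then lker (free_cover (syzygy M k)) else M.

Definition syzygy_diff (M : lmodType A) (n : nat) :
    {linear free_module A (syzygy M n.+1) -> free_module A (syzygy M n)} :=
  @lker_val _ _ (free_cover (syzygy M n)) \o free_cover (syzygy M n.+1).

Lemma free_cover_surj (M : lmodType A) x : exists y, free_cover M y = x.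
Proof. by exists (free_tens 1 << x >>); apply: free_lift_gen. Qed.

Lemma syzygy_exact (M : lmodType A) (n : nat) x :
  free_cover (syzygy M n) x = 0 <-> exists y, syzygy_diff M n y = x.
Proof.
split=> [x0|[y <-]].
  have xk : x \in lker_pred (free_cover (syzygy M n)) by apply/eqP.
  have [y yE] := free_cover_surj (Sub x xk : lker _).
  by exists y; rewrite /= yE.
by apply/eqP; rewrite -[_ == 0]/(_ \in lker_pred _) (valP (free_cover _ y)).
Qed.

Lemma projective_resolution_exists (M : lmodType A) :
  inhabited (projective_resolution M).
Proof.
apply: inhabits.
apply: (@ProjectiveResolution A M (fun n => free_module A (syzygy M n))
  (syzygy_diff M) (free_cover M)).
- by move=> n; apply: free_module_projective.
- exact: free_cover_surj.
- by move=> x; apply: (@syzygy_exact M 0 x).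
- move=> n x; rewrite -syzygy_exact; split=> [dx0|x0].
    by apply: val_inj; rewrite raddf0.
  by rewrite /= x0 raddf0.
Qed.

End Existence.

(* Main.v *)
(* RG is a Frobenius extension of RH: it is free on coset representatives of H,
   and the projection RG -> RH is an RH-bimodule map for which representatives
   and their inverses are dual bases. For any Frobenius extension A of S, the
   coinduction Hom_S(A, -) is both left and right adjoint to restriction; hence
   both functors are exact and preserve projectives and injectives, on either
   side. When the form A -> S maps 1 to 1, E ⊗_S P is naturally a retract of
   Hom_S(A, E) ⊗_A Hom_S(A, P), which bounds the copure flat dimension of an
   S-module by that of its coinduction. When A is separable over S with
   separability element \sum a_i ⊗ b_i, the map e ⊗ q |-> \sum e a_i ⊗ b_i q
   makes E ⊗_A Q a natural retract of E ⊗_S Q, which bounds the copure flat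
   dimension of an A-module by that of its restriction. *)

Require Import Defs.
From HB Require Import structures.
From mathcomp Require Import all_fingroup.
From mathcomp Require Import all_boot all_order all_algebra.
From mathcomp Require Import boolp classical_sets functions.
From mathcomp Require Import constructive_ereal freeg.

Set Implicit Arguments.
Unset Strict Implicit.
Unset Printing Implicit Defensive.

Import Order.TTheory GRing.Theory Num.Theory.
Local Open Scope ring_scope.

(** The proof [hP] stays an argument, so that unification can recover the linear structure of [h]
    from the term itself. *)
Definition linear_map (A : pzRingType) (U V : lmodType A) (h : U -> V)
  (hP : linear h) : U -> V := h.
HB.instance Definition _ (A : pzRingType) (U V : lmodType A) (h : U -> V)
  (hP : linear h) := GRing.isLinear.Build A U V *:%R (linear_map hP) hP.

(** * Restriction of scalars *)

Definition restr (S A : pzRingType) (f : {rmorphism S -> A}) (N : lmodType A) : Type :=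
  N.

Section Restriction.
Variables (S A : pzRingType) (f : {rmorphism S -> A}).
Local Notation restr := (restr f).

Section Scale.
Variable N : lmodType A.
HB.instance Definition _ := GRing.Zmodule.on (restr N).

Definition restr_scale (s : S) (x : restr N) : restr N := f s *: (x : N).

Let restr_scaleA a b x : restr_scale a (restr_scale b x) = restr_scale (a * b) x.
Proof. by rewrite /restr_scale rmorphM scalerA. Qed.
Let restr_scale1 : left_id 1 restr_scale.
Proof. by move=> x; rewrite /restr_scale rmorph1 scale1r. Qed.
Let restr_scaleDr : right_distributive restr_scale +%R.
Proof. by move=> a x y; rewrite /restr_scale scalerDr. Qed.
Let restr_scaleDl x : {morph restr_scale^~ x : a b / a + b}.
Proof. by move=> a b; rewrite /restr_scale rmorphD scalerDl. Qed.
HB.instance Definition _ := GRing.Zmodule_isLmodule.Build S (restr N)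
  restr_scaleA restr_scale1 restr_scaleDr restr_scaleDl.

Lemma restrZ (s : S) (x : restr N) : s *: x = f s *: (x : N).
Proof. by []. Qed.
End Scale.

Section Map.
Variables (M N : lmodType A) (h : {linear M -> N}).
Lemma restr_map_linear : linear (h : restr M -> restr N).
Proof. by move=> s x y; rewrite !restrZ linearP. Qed.
Definition restr_map : {linear restr M -> restr N} := linear_map restr_map_linear.
End Map.
End Restriction.

(** * The coinduced module *)

Section Coinduction.
Variables (S A : pzRingType) (f : {rmorphism S -> A}).

Section Module.
Variable Y : lmodType S.

(* Hom_S(A, Y), where A acts by (a phi)(b) = phi (b a). *)
Definition coind_pred : {pred A -> Y} := fun phi =>
  `[< zmod_morphism phi /\ forall s a, phi (f s * a) = s *: phi a >].

Let coind_zmod : zmod_closed coind_pred.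
Proof.
split=> [|phi psi]; first by apply/asboolP; split=> [a b|s a] /=; rewrite ?subr0 ?scaler0.
move=> /asboolP[pB pZ] /asboolP[qB qZ]; apply/asboolP; split=> [a b|s a].
  rewrite -[LHS]/(phi (a - b) - psi (a - b)) pB qB opprD addrACA.
  by rewrite -[RHS]/(phi a - psi a - (phi b - psi b)) [in RHS]opprD.
by rewrite -[LHS]/(phi (f s * a) - psi (f s * a)) pZ qZ -scalerBr.
Qed.
HB.instance Definition _ :=
  GRing.isZmodClosed.Build (A -> Y) coind_pred coind_zmod.

Definition coind : Type := {phi : A -> Y | phi \in coind_pred}.
HB.instance Definition _ := [isSub of coind for sval].
HB.instance Definition _ := [Choice of coind by <:].
HB.instance Definition _ := [SubChoice_isSubZmodule of coind by <:].

Definition coind_app (phi : coind) (a : A) : Y := val phi a.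

Lemma coind_eqP (phi psi : coind) : coind_app phi =1 coind_app psi -> phi = psi.
Proof. by move=> h; apply/val_inj/funext. Qed.

Lemma coind_appB (phi : coind) : zmod_morphism (coind_app phi).
Proof. by have /asboolP[] := valP phi. Qed.
HB.instance Definition _ (phi : coind) :=
  GRing.isZmodMorphism.Build A Y (coind_app phi) (coind_appB phi).

Lemma coind_appZ (phi : coind) s a : coind_app phi (f s * a) = s *: coind_app phi a.
Proof. by have /asboolP[] := valP phi. Qed.

Definition coind_of (phi : A -> Y) (phiB : zmod_morphism phi)
  (phiZ : forall s a, phi (f s * a) = s *: phi a) : coind :=
  Sub phi (asboolT (conj phiB phiZ)).

Lemma coind_ofE phi phiB phiZ a : coind_app (@coind_of phi phiB phiZ) a = phi a.
Proof. by []. Qed.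

Lemma coind_addE (phi psi : coind) a :
  coind_app (phi + psi) a = coind_app phi a + coind_app psi a.
Proof. by []. Qed.
Lemma coind0E a : coind_app 0 a = 0.
Proof. by []. Qed.
Lemma coind_sumE (I : Type) (r : seq I) (F : I -> coind) a :
  coind_app (\sum_(i <- r) F i) a = \sum_(i <- r) coind_app (F i) a.
Proof. exact: (big_morph (fun p => coind_app p a)). Qed.

Let coind_scale_additive (a : A) (phi : coind) :
  zmod_morphism (fun b => coind_app phi (b * a)).
Proof. by move=> b c /=; rewrite mulrBl raddfB. Qed.
Let coind_scale_scalable (a : A) (phi : coind) s b :
  coind_app phi (f s * b * a) = s *: coind_app phi (b * a).
Proof. by rewrite -mulrA coind_appZ. Qed.
Definition coind_scale (a : A) (phi : coind) : coind :=
  coind_of (coind_scale_additive a phi) (coind_scale_scalable a phi).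

Let coind_scaleA a b x : coind_scale a (coind_scale b x) = coind_scale (a * b) x.
Proof. by apply: coind_eqP => c; rewrite !coind_ofE mulrA. Qed.
Let coind_scale1 : left_id 1 coind_scale.
Proof. by move=> x; apply: coind_eqP => c; rewrite !coind_ofE mulr1. Qed.
Let coind_scaleDr : right_distributive coind_scale +%R.
Proof. by move=> a x y; apply: coind_eqP. Qed.
Let coind_scaleDl x : {morph coind_scale^~ x : a b / a + b}.
Proof. by move=> a b; apply: coind_eqP => c; rewrite coind_addE !coind_ofE mulrDr raddfD. Qed.
HB.instance Definition _ := GRing.Zmodule_isLmodule.Build A coind
  coind_scaleA coind_scale1 coind_scaleDr coind_scaleDl.

Lemma coindZE (a : A) (phi : coind) b : coind_app (a *: phi) b = coind_app phi (b * a).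
Proof. by []. Qed.

End Module.
End Coinduction.

(** * Coinduction as the right adjoint of restriction *)

Section RightAdjoint.
Variables (S A : pzRingType) (f : {rmorphism S -> A}).

(** Reading the scalar in [A] lets it merge with other scalars of [A] through [scalerA]. *)
Lemma restr_linearZ (Y : lmodType S) (N : lmodType A) (g : {linear Y -> restr f N})
  s u : (g (s *: u) : N) = f s *: (g u : N).
Proof. by rewrite linearZ. Qed.

Section Map.
Variables (X Y : lmodType S) (h : {linear X -> Y}).

Let map_additive (phi : coind f X) : zmod_morphism (fun a => h (coind_app phi a)).
Proof. by move=> a b /=; rewrite !raddfB. Qed.
Let map_scalable (phi : coind f X) s a :
  h (coind_app phi (f s * a)) = s *: h (coind_app phi a).
Proof. by rewrite coind_appZ linearZ. Qed.
Let map_linear :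
  linear (fun phi => coind_of (map_additive phi) (map_scalable phi) : coind f Y).
Proof. by move=> a phi psi; apply: coind_eqP => b; rewrite coind_addE !coind_ofE raddfD. Qed.
Definition coind_map : {linear coind f X -> coind f Y} := linear_map map_linear.

Lemma coind_mapE phi a : coind_app (coind_map phi) a = h (coind_app phi a).
Proof. by []. Qed.

Lemma coind_map_inj : injective h -> injective coind_map.
Proof.
move=> h_inj phi psi e; apply: coind_eqP => a; apply: h_inj.
by rewrite -!coind_mapE e.
Qed.
End Map.

Section Curry.
Variables (N : lmodType A) (Y : lmodType S) (g : {linear restr f N -> Y}).

Let curry_additive (x : N) : zmod_morphism (fun a : A => g (a *: x)).
Proof. by move=> a b /=; rewrite scalerBl (raddfB g). Qed.
Let curry_scalable (x : N) s (a : A) : g ((f s * a) *: x) = s *: g (a *: x).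
Proof. by rewrite -linearZ restrZ scalerA. Qed.
Let curry_linear :
  linear (fun x => coind_of (curry_additive x) (curry_scalable x) : coind f Y).
Proof.
move=> a x y; apply: coind_eqP => b.
by rewrite coind_addE coindZE !coind_ofE scalerDr scalerA (raddfD g).
Qed.
(** The transpose of [g] under the adjunction; evaluation at 1, [coind_eval], is the counit. *)
Definition coind_curry : {linear N -> coind f Y} := linear_map curry_linear.

Lemma coind_curryE x a : coind_app (coind_curry x) a = g (a *: x).
Proof. by []. Qed.
End Curry.

Section Eval.
Variable Y : lmodType S.
Let eval_linear : linear (fun phi : restr f (coind f Y) => coind_app phi 1).
Proof.
move=> s phi psi.
by rewrite -coind_appZ mulr1 [LHS]coind_addE coindZE mul1r.
Qed.
Definition coind_eval : {linear restr f (coind f Y) -> Y} := linear_map eval_linear.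
End Eval.

(** Restriction preserves injective maps, so its right adjoint preserves injective modules:
    transpose [h], extend it over S, and transpose back. *)
Lemma coind_injective (E : lmodType S) :
  injective_module E -> injective_module (coind f E).
Proof.
move=> E_inj X Y i h i_inj.
have [g gE] := E_inj _ _ (restr_map f i) (coind_eval E \o restr_map f h) i_inj.
exists (coind_curry g) => x; apply: coind_eqP => a.
rewrite coind_curryE -linearZ (gE (a *: x)).
by rewrite /= /linear_map linearZ coindZE mul1r.
Qed.

End RightAdjoint.

(* The two identities make (x_i) and (y_i) dual bases of A over S for the form
   [frob_form]: A is a Frobenius extension of S. *)
Record frobenius_system (S A : pzRingType) (f : {rmorphism S -> A}) :=
  FrobeniusSystem {
    frob_form : {additive A -> S};
    frob_idx : finType;
    frob_x : frob_idx -> A;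
    frob_y : frob_idx -> A;
    frob_formZl : forall s a, frob_form (f s * a) = s * frob_form a;
    frob_formZr : forall a s, frob_form (a * f s) = frob_form a * s;
    frob_dual_l : forall a, \sum_i f (frob_form (a * frob_x i)) * frob_y i = a;
    frob_dual_r : forall a, \sum_i frob_x i * f (frob_form (frob_y i * a)) = a }.

(** * Coinduction along a Frobenius extension: exactness and left adjointness to restriction *)

Section LeftAdjoint.
Variables (S A : pzRingType) (f : {rmorphism S -> A}) (F : frobenius_system f).
Local Notation pi := (frob_form F).
Local Notation x := (@frob_x _ _ _ F).
Local Notation y := (@frob_y _ _ _ F).

Lemma coind_app_dual (Y : lmodType S) (phi : coind f Y) a :
  coind_app phi a = \sum_i pi (a * x i) *: coind_app phi (y i).
Proof.
rewrite -[in LHS](frob_dual_l F a) raddf_sum; apply: eq_bigr => i _.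
by rewrite /= coind_appZ.
Qed.

Section Interpolation.
Variables (Y : lmodType S) (u : frob_idx F -> Y).
Let interp_additive : zmod_morphism (fun a => \sum_i pi (a * x i) *: u i).
Proof.
move=> a b; rewrite -sumrB; apply: eq_bigr => i _.
by rewrite mulrBl raddfB scalerBl.
Qed.
Let interp_scalable s a :
  \sum_i pi (f s * a * x i) *: u i = s *: \sum_i pi (a * x i) *: u i.
Proof.
by rewrite scaler_sumr; apply: eq_bigr => i _; rewrite -mulrA frob_formZl scalerA.
Qed.
(** The family [u] is arbitrary, and the value at [y j] need not be [u j], as the [y i] may be
    linearly dependent. By [coind_app_dual], a coinduced element is recovered from its own values on
    the [y i]. *)
Definition coind_interp : coind f Y := coind_of interp_additive interp_scalable.
End Interpolation.

(** Preimages of the finitely many values of [w] on the [y i] are interpolated. The image of the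
    interpolation is the dual basis expansion of [w], hence [w] itself. *)
Lemma coind_map_exact (X Y Z : lmodType S) (g : {linear X -> Y}) (h : {linear Y -> Z}) :
  (forall w, h w = 0 <-> exists z, g z = w) ->
  forall w, coind_map f h w = 0 <-> exists z, coind_map f g z = w.
Proof.
move=> gh w; split=> [w0|[z <-]]; last first.
  by apply: coind_eqP => a; rewrite !coind_mapE coind0E; apply/gh; exists (coind_app z a).
have /boolp.choice[u uE] i : exists z, g z = coind_app w (y i).
  by apply/gh; rewrite -coind_mapE w0.
exists (coind_interp u); apply: coind_eqP => a.
rewrite [RHS]coind_app_dual coind_mapE coind_ofE raddf_sum; apply: eq_bigr => i _.
by rewrite /= linearZ uE.
Qed.

Lemma coind_map_surj (X Y : lmodType S) (g : {linear X -> Y}) :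
  (forall w, exists z, g z = w) -> forall w, exists z, coind_map f g z = w.
Proof.
move=> g_surj w; have /boolp.choice[u uE] i : exists z, g z = coind_app w (y i).
  exact: g_surj.
exists (coind_interp u); apply: coind_eqP => a.
rewrite [RHS]coind_app_dual coind_mapE coind_ofE raddf_sum; apply: eq_bigr => i _.
by rewrite /= linearZ uE.
Qed.

Section Unit.
Variable Y : lmodType S.
Let unit_additive (u : Y) : zmod_morphism (fun a => pi a *: u).
Proof. by move=> a b /=; rewrite raddfB scalerBl. Qed.
Let unit_scalable (u : Y) s a : pi (f s * a) *: u = s *: (pi a *: u).
Proof. by rewrite frob_formZl scalerA. Qed.
Let unit_linear : linear
  (fun u => coind_of (unit_additive u) (unit_scalable u) : restr f (coind f Y)).
Proof.
move=> s u v; apply: coind_eqP => a.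
rewrite [RHS]coind_addE restrZ coindZE !coind_ofE.
by rewrite frob_formZr scalerDr scalerA.
Qed.
(** The unit of the adjunction with coinduction on the left; its S-linearity rests on the right
    S-linearity of the form. *)
Definition coind_unit : {linear Y -> restr f (coind f Y)} := linear_map unit_linear.

Lemma coind_unitE u a : coind_app (coind_unit u : coind f Y) a = pi a *: u.
Proof. by []. Qed.

(** The image of the unit generates the coinduced module over [A], so an A-linear map is determined
    by its composite with the unit. This forces the formula of [coind_ext]. *)
Lemma coind_unit_dual (phi : coind f Y) :
  \sum_i x i *: (coind_unit (coind_app phi (y i)) : coind f Y) = phi.
Proof.
apply: coind_eqP => a; rewrite coind_sumE [RHS]coind_app_dual; apply: eq_bigr => i _.
by rewrite coindZE coind_unitE.
Qed.
End Unit.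

Lemma coind_unit_map (X Y : lmodType S) (g : {linear X -> Y}) u :
  coind_map f g (coind_unit X u) = coind_unit Y (g u).
Proof. by apply: coind_eqP => a; rewrite coind_mapE !coind_unitE linearZ. Qed.

Section Extension.
Variables (N : lmodType A) (Y : lmodType S) (g : {linear Y -> restr f N}).
Let ext_linear :
  linear (fun phi : coind f Y => \sum_i x i *: (g (coind_app phi (y i)) : N)).
Proof.
move=> a phi psi; rewrite scaler_sumr.
under eq_bigr => i _ do rewrite coind_addE raddfD scalerDr.
rewrite big_split; congr (_ + _).
(* The value of [phi] at [y i * a] is expanded in the dual bases. After exchanging the sums,
   [frob_dual_r] for [a * x j] collapses the sum over [i]. *)
under eq_bigr => i _.
  rewrite coindZE coind_app_dual raddf_sum /= scaler_sumr.
  under eq_bigr => j _ do rewrite restr_linearZ scalerA -mulrA.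
  over.
rewrite exchange_big; apply: eq_bigr => j _ /=.
by rewrite -scaler_suml frob_dual_r scalerA.
Qed.
Definition coind_ext : {linear coind f Y -> N} := linear_map ext_linear.

Lemma coind_extE phi :
  coind_ext phi = \sum_i x i *: (g (coind_app phi (y i)) : N).
Proof. by []. Qed.

Lemma coind_ext_unit u : coind_ext (coind_unit Y u) = g u.
Proof.
rewrite coind_extE -[RHS](@scale1r A N) -(frob_dual_r F 1) scaler_suml.
by apply: eq_bigr => i _; rewrite coind_unitE mulr1 restr_linearZ scalerA.
Qed.
End Extension.

(** Coinduction is left adjoint to restriction, and restriction preserves surjections. *)
Lemma coind_projective (P : lmodType S) :
  projective_module P -> projective_module (coind f P).
Proof.
move=> P_proj X Y p h p_surj.
have [g gE] := P_proj _ _ (restr_map f p) (restr_map f h \o coind_unit P) p_surj.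
exists (coind_ext g) => phi.
rewrite -[in RHS](coind_unit_dual phi) coind_extE !raddf_sum.
apply: eq_bigr => i _; rewrite /= !linearZ.
by congr (_ *: _); apply: gE.
Qed.

(** Restriction is left adjoint to coinduction, which preserves surjections by [coind_map_surj]. The
    lift is transposed back by evaluating at 1. *)
Lemma restr_projective (N : lmodType A) :
  projective_module N -> projective_module (restr f N).
Proof.
move=> N_proj X Y p h p_surj.
have [g gE] := N_proj _ _ (coind_map f p) (coind_curry h) (coind_map_surj p_surj).
exists (coind_eval f X \o restr_map f g) => u.
have -> : h u = coind_app (coind_curry h u) 1 by rewrite coind_curryE scale1r.
by rewrite -gE.
Qed.

(** Restriction is also right adjoint to coinduction, which preserves injective maps. *)
Lemma restr_injective (N : lmodType A) :
  injective_module N -> injective_module (restr f N).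
Proof.
move=> N_inj X Y i h i_inj.
have [g gE] := N_inj _ _ (coind_map f i) (coind_ext h) (coind_map_inj i_inj).
exists (restr_map f g \o coind_unit Y) => u.
by rewrite -(coind_ext_unit h u) -gE coind_unit_map.
Qed.

End LeftAdjoint.

(** * Tensor products over a ring, and exactness of retracts *)

Section ModTensor.
Variables (A : pzRingType) (E : lmodType A^c) (M : lmodType A).

Definition mtens (e : E) (m : M) : mod_tensor E M := tens _ _ e m.

Lemma mtens_balanced :
  balanced (fun (e : E) (a : A) => (a : A^c) *: e) (fun (a : A) (m : M) => a *: m)
    mtens.
Proof. exact: tens_balanced. Qed.

Lemma mtensDl e e' m : mtens (e + e') m = mtens e m + mtens e' m.
Proof. by have [] := mtens_balanced. Qed.

Lemma mtensDr e m m' : mtens e (m + m') = mtens e m + mtens e m'.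
Proof. by have [] := mtens_balanced. Qed.

Lemma mtensA e (a : A) m : mtens ((a : A^c) *: e) m = mtens e (a *: m).
Proof. by have [_ _] := mtens_balanced; apply. Qed.

Lemma mtens_suml (I : Type) (r : seq I) (F : I -> E) m :
  mtens (\sum_(i <- r) F i) m = \sum_(i <- r) mtens (F i) m.
Proof.
apply: (big_morph (mtens^~ m)) => [e e'|]; first exact: mtensDl.
by apply: (addrI (mtens 0 m)); rewrite -mtensDl !addr0.
Qed.

Lemma mtens_sumr (I : Type) (r : seq I) (F : I -> M) e :
  mtens e (\sum_(i <- r) F i) = \sum_(i <- r) mtens e (F i).
Proof.
apply: (big_morph (mtens e)) => [m m'|]; first exact: mtensDr.
by apply: (addrI (mtens e 0)); rewrite -mtensDr !addr0.
Qed.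

Lemma mod_tensor_ext (V : zmodType) (h k : mod_tensor E M -> V) :
  zmod_morphism h -> zmod_morphism k ->
  (forall e m, h (mtens e m) = k (mtens e m)) -> h =1 k.
Proof.
by move=> hB kB hk; elim/tensor_ind=> [e m|t u]; [exact: hk|rewrite hB kB => -> ->].
Qed.
End ModTensor.

Lemma id_tensor_mtens (A : pzRingType) (E : lmodType A^c) (M N : lmodType A)
  (g : {linear M -> N}) e m : id_tensor (E := E) g (mtens e m) = mtens e (g m).
Proof. exact: id_tensorE. Qed.

(** A cycle [t] goes to the cycle [a1 t]; if [v] bounds it, then [b2 v] bounds [b1 (a1 t) = t]. The
    maps [a] thus act in degrees 0 and 1, the maps [b] in degrees 1 and 2. *)
Lemma exact_retract (T0 T1 T2 U0 U1 U2 : zmodType)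
    (d1 : T1 -> T0) (d2 : T2 -> T1) (d1' : U1 -> U0) (d2' : U2 -> U1)
    (a0 : T0 -> U0) (a1 : T1 -> U1) (b1 : U1 -> T1) (b2 : U2 -> T2) :
  a0 0 = 0 -> cancel a1 b1 ->
  (forall t, d1' (a1 t) = a0 (d1 t)) -> (forall u, b1 (d2' u) = d2 (b2 u)) ->
  (forall u, d1' u = 0 -> exists v, d2' v = u) ->
  forall t, d1 t = 0 -> exists v, d2 v = t.
Proof.
move=> a00 aK d1a d2b ex t t0.
have [|v vE] := ex (a1 t); first by rewrite d1a t0.
by exists (b2 v); rewrite -d2b vE aK.
Qed.

(** * Passage to opposite rings, which carries the results on left modules over to right modules *)

Section Converse.
Variables (S A : pzRingType) (f : {rmorphism S -> A}).

Definition conv_fun : S^c -> A^c := f.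
Let conv_fun_additive : zmod_morphism conv_fun.
Proof. by move=> a b; apply: (raddfB f). Qed.
Let conv_fun_monoid : monoid_morphism conv_fun.
Proof. by split=> [|a b]; [exact: (rmorph1 f)|exact: (rmorphM f)]. Qed.
HB.instance Definition _ :=
  GRing.isZmodMorphism.Build S^c A^c conv_fun conv_fun_additive.
HB.instance Definition _ :=
  GRing.isMonoidMorphism.Build S^c A^c conv_fun conv_fun_monoid.

Definition conv_map : {rmorphism S^c -> A^c} := conv_fun.

Variable F : frobenius_system f.
Definition conv_form : A^c -> S^c := frob_form F.
Let conv_form_additive : zmod_morphism conv_form.
Proof. by move=> a b; apply: (raddfB (frob_form F)). Qed.
HB.instance Definition _ :=
  GRing.isZmodMorphism.Build A^c S^c conv_form conv_form_additive.

(* Passing to opposite rings exchanges the two dual bases. *)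
Definition frobenius_conv : frobenius_system conv_map :=
  @FrobeniusSystem S^c A^c conv_map conv_form (frob_idx F) (@frob_y _ _ _ F)
    (@frob_x _ _ _ F) (fun s a => frob_formZr F a s) (fun a s => frob_formZl F s a)
    (frob_dual_r F) (frob_dual_l F).
End Converse.

(** * Coinduced and restricted projective resolutions *)

Section CoinducedResolution.
Variables (S A : pzRingType) (f : {rmorphism S -> A}) (F : frobenius_system f).
Variables (M : lmodType S) (P : projective_resolution M).

Definition coind_resolution : projective_resolution (coind f M) :=
  @ProjectiveResolution A (coind f M) (fun n => coind f (res_mod P n))
    (fun n => coind_map f (res_diff P n)) (coind_map f (res_aug P))
    (fun n => coind_projective F (@res_projective _ _ P n))
    (coind_map_surj F (@res_aug_surj _ _ P))
    (coind_map_exact F (@res_exact0 _ _ P))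
    (fun n => coind_map_exact F (@res_exactS _ _ P n)).
End CoinducedResolution.

Section RestrictedResolution.
Variables (S A : pzRingType) (f : {rmorphism S -> A}) (F : frobenius_system f).
Variables (N : lmodType A) (Q : projective_resolution N).

Definition restr_resolution : projective_resolution (restr f N) :=
  @ProjectiveResolution S (restr f N) (fun n => restr f (res_mod Q n))
    (fun n => restr_map f (res_diff Q n)) (restr_map f (res_aug Q))
    (fun n => restr_projective F (@res_projective _ _ Q n))
    (@res_aug_surj _ _ Q) (@res_exact0 _ _ Q) (@res_exactS _ _ Q).
End RestrictedResolution.

(** * Tensor products over S as retracts of tensor products of coinduced modules *)

Section CoinducedTensor.
Variables (S A : pzRingType) (f : {rmorphism S -> A}) (F : frobenius_system f).
Variable E : lmodType S^c.
Local Notation Fc := (frobenius_conv F).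
Local Notation coindE := (coind (conv_map f) E).
Local Notation pi := (frob_form F).
Local Notation x := (@frob_x _ _ _ F).
Local Notation y := (@frob_y _ _ _ F).

Section Maps.
Variable X : lmodType S.

Definition coind_tensor_in : mod_tensor E X -> mod_tensor coindE (coind f X) :=
  tensor_lift (fun e m => mtens (coind_unit Fc E e : coindE)
                                (coind_unit F X m : coind f X)).
(** Here [psi] is evaluated on the [x i] and [phi] on the [y i], because the two dual bases change
    places over the opposite rings. *)
Definition coind_tensor_out : mod_tensor coindE (coind f X) -> mod_tensor E X :=
  tensor_lift (fun (psi : coindE) (phi : coind f X) =>
    \sum_i mtens (coind_app psi (x i)) (coind_app phi (y i))).

Let in_bal : balanced (fun (e : E) (s : S) => (s : S^c) *: e)
  (fun (s : S) (m : X) => s *: m)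
  (fun e m => mtens (coind_unit Fc E e : coindE) (coind_unit F X m : coind f X)).
Proof.
split=> [e e' m|e m m'|e s m].
- by rewrite raddfD; apply: mtensDl.
- by rewrite raddfD; apply: mtensDr.
- by rewrite !restr_linearZ; apply: mtensA.
Qed.

Let out_bal : balanced (fun (psi : coindE) (a : A) => (a : A^c) *: psi)
  (fun (a : A) (phi : coind f X) => a *: phi)
  (fun (psi : coindE) (phi : coind f X) =>
     \sum_i mtens (coind_app psi (x i)) (coind_app phi (y i))).
Proof.
split=> [psi psi' phi|psi phi phi'|psi a phi].
- by rewrite -big_split; apply: eq_bigr => i _; apply: mtensDl.
- by rewrite -big_split; apply: eq_bigr => i _; apply: mtensDr.
(* Both sides are the double sum of psi(x_i) ⊗ pi(y_i a x_j) phi(y_j): summing over [i] first gives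
   psi(a x_j), summing over [j] first gives phi(y_i a). *)
under eq_bigr => j _.
  rewrite coindZE (coind_app_dual Fc) mtens_suml.
  under eq_bigr => i _ do rewrite mtensA.
  over.
rewrite exchange_big; apply: eq_bigr => i _ /=.
rewrite -mtens_sumr coindZE (coind_app_dual F); congr (mtens _ _).
by apply: eq_bigr => j _; congr (_ *: _); apply: (congr1 pi (mulrA (y i) a (x j))).
Qed.

Lemma coind_tensor_inB : zmod_morphism coind_tensor_in.
Proof. exact: (tensor_lift_is_additive in_bal). Qed.
Lemma coind_tensor_outB : zmod_morphism coind_tensor_out.
Proof. exact: (tensor_lift_is_additive out_bal). Qed.
Lemma coind_tensor_inE e m : coind_tensor_in (mtens e m) =
  mtens (coind_unit Fc E e : coindE) (coind_unit F X m : coind f X).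
Proof. exact: (tensor_lift_tens in_bal). Qed.
Lemma coind_tensor_outE psi phi : coind_tensor_out (mtens psi phi) =
  \sum_i mtens (coind_app psi (x i)) (coind_app phi (y i)).
Proof. exact: (tensor_lift_tens out_bal). Qed.

Lemma coind_tensor_inK : pi 1 = 1 -> cancel coind_tensor_in coind_tensor_out.
Proof.
move=> pi1.
(* The round trip sends e ⊗ m to the sum of e pi(x_i) ⊗ pi(y_i) m, so this scalar must be 1. It is
   [pi 1], as seen by applying [pi] to the dual basis expansion of 1. *)
have pi_dual : \sum_i pi (x i) * pi (y i) = 1.
  rewrite -[RHS]pi1 -[in RHS](frob_dual_r F 1) raddf_sum.
  by apply: eq_bigr => i _; rewrite mulr1 /= frob_formZr.
apply: mod_tensor_ext => [t u||e m]; last 1 first.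
- rewrite coind_tensor_inE coind_tensor_outE.
  under eq_bigr => i _ do rewrite !coind_unitE mtensA scalerA.
  by rewrite -mtens_sumr -scaler_suml pi_dual scale1r.
- by rewrite coind_tensor_inB coind_tensor_outB.
- by [].
Qed.
End Maps.

Lemma coind_tensor_in_nat (X Y : lmodType S) (g : {linear X -> Y}) t :
  id_tensor (coind_map f g) (coind_tensor_in t) = coind_tensor_in (id_tensor g t).
Proof.
move: t; apply: mod_tensor_ext => [t u|t u|e m].
- by rewrite coind_tensor_inB raddfB.
- by rewrite raddfB coind_tensor_inB.
- by rewrite id_tensor_mtens !coind_tensor_inE id_tensor_mtens coind_unit_map.
Qed.

Lemma coind_tensor_out_nat (X Y : lmodType S) (g : {linear X -> Y}) t :
  coind_tensor_out (id_tensor (coind_map f g) t) = id_tensor g (coind_tensor_out t).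
Proof.
move: t; apply: mod_tensor_ext => [t u|t u|e m].
- by rewrite raddfB coind_tensor_outB.
- by rewrite coind_tensor_outB raddfB.
- rewrite id_tensor_mtens !coind_tensor_outE raddf_sum.
  by apply: eq_bigr => i _; rewrite /= id_tensor_mtens.
Qed.
End CoinducedTensor.

(** The hypothesis is applied to the injective right module coinduced from [E] and to the resolution
    coinduced from [P]; exactness then passes to the retract E ⊗_S P. *)
Theorem cfd_le_coind (S A : pzRingType) (f : {rmorphism S -> A})
    (F : frobenius_system f) (M : lmodType S) n :
  frob_form F 1 = 1 -> cfd_le (coind f M) n -> cfd_le M n.
Proof.
move=> pi1 cM E E_inj i i1 P.
have := cM _ (coind_injective (f := conv_map f) E_inj) i i1 (coind_resolution F P).
(* As [i] is at least 1, the degree is a successor, and vanishing of homology means exactness at an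
   inner term. *)
case: (n + i)%N (leq_trans i1 (leq_addl n i)) => // k _ /= ex.
apply: (exact_retract (a0 := @coind_tensor_in _ _ f F E _)
  _ (coind_tensor_inK pi1) _ _ ex).
- by rewrite -(subrr 0) coind_tensor_inB subrr.
- exact: coind_tensor_in_nat.
- exact: coind_tensor_out_nat.
Qed.

(** * Tensor products over A as retracts of tensor products over S, in the separable case *)

Section SeparableTensor.
Variables (S A : pzRingType) (f : {rmorphism S -> A}) (ab : seq (A * A)).
Hypothesis ab_comm : forall a : A,
  \sum_(p <- ab) (tens _ _ p.1 (p.2 * a) : ext_tensor f) =
  \sum_(p <- ab) (tens _ _ (a * p.1) p.2 : ext_tensor f).
Variable E : lmodType A^c.
Local Notation rE := (restr (conv_map f) E).

Section Maps.
Variable X : lmodType A.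

Definition sep_tensor_in : mod_tensor E X -> mod_tensor rE (restr f X) :=
  tensor_lift (fun e m => \sum_(p <- ab)
    mtens ((p.1 : A^c) *: e : rE) (p.2 *: m : restr f X)).
Definition sep_tensor_out : mod_tensor rE (restr f X) -> mod_tensor E X :=
  tensor_lift (fun e m => mtens (e : E) (m : X)).

(** For fixed [e] and [m] this gives a map on A ⊗_S A, through which the identity [ab_comm] can be
    transported. *)
Let ext_bal (e : E) (m : X) :
  balanced (fun (a : A) (s : S) => a * f s) (fun (s : S) (b : A) => f s * b)
    (fun a b => mtens ((a : A^c) *: e : rE) (b *: m : restr f X)).
Proof.
split=> [a a' b|a b b'|a s b].
- by rewrite (scalerDl e (a : A^c) a'); apply: mtensDl.
- by rewrite scalerDl; apply: mtensDr.
- have -> : ((a * f s : A) : A^c) *: e = (f s : A^c) *: ((a : A^c) *: e).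
    by rewrite scalerA.
  by rewrite -scalerA; apply: mtensA.
Qed.

Let in_bal : balanced (fun (e : E) (a : A) => (a : A^c) *: e)
  (fun (a : A) (m : X) => a *: m)
  (fun e m => \sum_(p <- ab) mtens ((p.1 : A^c) *: e : rE) (p.2 *: m : restr f X)).
Proof.
split=> [e e' m|e m m'|e a m].
- by rewrite -big_split; apply: eq_bigr => p _; rewrite scalerDr; apply: mtensDl.
- by rewrite -big_split; apply: eq_bigr => p _; rewrite scalerDr; apply: mtensDr.
have lB := tensor_lift_is_additive (ext_bal e m).
have l0 : tensor_lift (fun a b => mtens ((a : A^c) *: e : rE) (b *: m : restr f X))
   (0 : ext_tensor f) = 0 by rewrite -(subrr 0) lB subrr.
(* The image of [ab_comm a] reads: the sum of e a_i ⊗ b_i a m equals the sum of e a a_i ⊗ b_i m.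
   This is balancedness over [A]. *)
have := congr1 (tensor_lift (fun a b => mtens ((a : A^c) *: e : rE) (b *: m : restr f X)))
  (ab_comm a).
rewrite !(big_morph _ (zmod_morphD lB) l0).
under eq_bigr => p _ do rewrite (tensor_lift_tens (ext_bal e m)).
under [RHS]eq_bigr => p _ do rewrite (tensor_lift_tens (ext_bal e m)).
under [X in _ -> _ = X]eq_bigr => p _ do rewrite scalerA.
by move=> ->; apply: eq_bigr => p _; rewrite scalerA.
Qed.

Let out_bal : balanced (fun (e : rE) (s : S) => (s : S^c) *: e)
  (fun (s : S) (m : restr f X) => s *: m) (fun e m => mtens (e : E) (m : X)).
Proof.
by split=> *; [exact: mtensDl|exact: mtensDr|exact: mtensA].
Qed.

Lemma sep_tensor_inB : zmod_morphism sep_tensor_in.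
Proof. exact: (tensor_lift_is_additive in_bal). Qed.
Lemma sep_tensor_outB : zmod_morphism sep_tensor_out.
Proof. exact: (tensor_lift_is_additive out_bal). Qed.
Lemma sep_tensor_inE e m : sep_tensor_in (mtens e m) =
  \sum_(p <- ab) mtens ((p.1 : A^c) *: e : rE) (p.2 *: m : restr f X).
Proof. exact: (tensor_lift_tens in_bal). Qed.
Lemma sep_tensor_outE (e : rE) (m : restr f X) :
  sep_tensor_out (mtens e m) = mtens (e : E) (m : X).
Proof. exact: (tensor_lift_tens out_bal). Qed.

Lemma sep_tensor_inK :
  \sum_(p <- ab) p.1 * p.2 = 1 -> cancel sep_tensor_in sep_tensor_out.
Proof.
move=> ab1; apply: mod_tensor_ext => [t u||e m]; last 1 first.
- rewrite sep_tensor_inE.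
  have out0 : sep_tensor_out 0 = 0 by rewrite -(subrr 0) sep_tensor_outB subrr.
  rewrite (big_morph _ (zmod_morphD sep_tensor_outB) out0).
  under eq_bigr => p _ do rewrite sep_tensor_outE mtensA scalerA.
  by rewrite -mtens_sumr -scaler_suml ab1 scale1r.
- by rewrite sep_tensor_inB sep_tensor_outB.
- by [].
Qed.
End Maps.

Lemma sep_tensor_in_nat (X Y : lmodType A) (g : {linear X -> Y}) t :
  id_tensor (restr_map f g) (sep_tensor_in t) = sep_tensor_in (id_tensor g t).
Proof.
move: t; apply: mod_tensor_ext => [t u|t u|e m].
- by rewrite sep_tensor_inB raddfB.
- by rewrite raddfB sep_tensor_inB.
- rewrite id_tensor_mtens !sep_tensor_inE raddf_sum; apply: eq_bigr => p _.
  by rewrite /= id_tensor_mtens -linearZ.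
Qed.

Lemma sep_tensor_out_nat (X Y : lmodType A) (g : {linear X -> Y}) t :
  sep_tensor_out (id_tensor (restr_map f g) t) = id_tensor g (sep_tensor_out t).
Proof.
move: t; apply: mod_tensor_ext => [t u|t u|e m].
- by rewrite raddfB sep_tensor_outB.
- by rewrite sep_tensor_outB raddfB.
- by rewrite id_tensor_mtens !sep_tensor_outE id_tensor_mtens.
Qed.
End SeparableTensor.

(** The Frobenius system makes the restrictions of [E] and of the terms of [Q] injective and
    projective; separability provides the retraction. *)
Theorem cfd_le_restr (S A : pzRingType) (f : {rmorphism S -> A})
    (F : frobenius_system f) (N : lmodType A) n :
  separable_extension f -> cfd_le (restr f N) n -> cfd_le N n.
Proof.
move=> [ab [ab_comm ab1]] cN E E_inj i i1 Q.
have := cN _ (restr_injective (frobenius_conv F) E_inj) i i1 (restr_resolution F Q).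
case: (n + i)%N (leq_trans i1 (leq_addl n i)) => // k _ /= ex.
apply: (exact_retract (a0 := @sep_tensor_in _ _ f ab E _)
  _ (sep_tensor_inK ab_comm ab1) _ _ ex).
- by rewrite -(subrr 0) (sep_tensor_inB ab_comm) subrr.
- exact: sep_tensor_in_nat.
- exact: sep_tensor_out_nat.
Qed.

(** * The skew group ring as a Frobenius extension of the subring of a subgroup *)

Section SkewFrobenius.
Variables (gT : finGroupType) (R : pzRingType) (act : ring_action gT R).
Variable H : {group gT}.
Local Notation RH := (skew_group_ring (restrict_action act H)).
Local Notation RG := (skew_group_ring act).
Local Notation incl := (@skew_incl gT R act H).

Definition skew_proj (a : RG) : RH := [ffun h => (a : {ffun gT -> R}) (sgval h)].

Let skew_proj_additive : zmod_morphism skew_proj.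
Proof. by move=> a b; apply/ffunP => h; rewrite !ffunE. Qed.
HB.instance Definition _ :=
  GRing.isZmodMorphism.Build RG RH skew_proj skew_proj_additive.

Lemma skew_inclE (b : RH) g : incl b g = if g \in H then b (subg H g) else 0.
Proof. exact: ffunE. Qed.

(** Identities in RH are checked after the injection into RG, where the projection becomes
    truncation to [H]. *)
Lemma skew_incl_proj (a : RG) g : incl (skew_proj a) g = if g \in H then a g else 0.
Proof. by rewrite skew_inclE ffunE; case: ifP => // gH; rewrite subgK. Qed.

Lemma skew_proj1 : skew_proj 1 = 1.
Proof.
apply: skew_incl_inj; apply/ffunP => g; rewrite skew_incl_proj rmorph1 skew1E.
by case: ifPn => // /negPf gH; case: eqP gH => // ->; rewrite group1.
Qed.

Lemma skew_projZl (b : RH) (a : RG) : skew_proj (incl b * a) = b * skew_proj a.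
Proof.
apply: skew_incl_inj; apply/ffunP => k.
rewrite skew_incl_proj rmorphM !skew_mulE; case: ifPn => kH.
  apply: eq_bigr => g _; rewrite skew_incl_proj skew_inclE.
  by case: ifPn => gH; rewrite ?mul0r // groupMl ?groupV // kH.
rewrite big1 // => g _; rewrite skew_incl_proj skew_inclE.
case: ifPn => gH; rewrite ?mul0r // groupMl ?groupV //.
by rewrite (negPf kH) rmorph0 mulr0.
Qed.

Lemma skew_projZr (a : RG) (b : RH) : skew_proj (a * incl b) = skew_proj a * b.
Proof.
apply: skew_incl_inj; apply/ffunP => k.
rewrite skew_incl_proj rmorphM !skew_mulE; case: ifPn => kH.
  apply: eq_bigr => g _; rewrite skew_incl_proj skew_inclE groupMr // groupV.
  by case: ifP => // _; rewrite rmorph0 mulr0 mul0r.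
rewrite big1 // => g _; rewrite skew_incl_proj skew_inclE.
case: ifPn => gH; rewrite ?mul0r // groupMl ?groupV //.
by rewrite (negPf kH) rmorph0 mulr0.
Qed.

Lemma skew_mul_termr (a : RG) g k : (a * skew_term act 1 g) k = a (k * g^-1)%g.
Proof.
rewrite skew_mulE (bigD1 (k * g^-1)%g) //= ffunE invMg invgK -mulgA mulVg mulg1 eqxx.
rewrite rmorph1 mulr1 big1 ?addr0 // => j /negPf jk; rewrite ffunE.
by rewrite -(inj_eq (mulgI j)) mulKVg -(inj_eq (mulIg g^-1%g)) mulgK eq_sym jk rmorph0 mulr0.
Qed.

Lemma skew_mul_terml (a : RG) g k : (skew_term act 1 g * a) k = act g (a (g^-1 * k)%g).
Proof.
rewrite skew_mulE (bigD1 g) //= ffunE eqxx mul1r big1 ?addr0 // => j /negPf jk.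
by rewrite ffunE jk mul0r.
Qed.

Definition rcoset_rep (g : gT) : bool := g == fingroup.repr (H :* g)%g.

Lemma rcoset_repE g k : rcoset_rep g && (k * g^-1 \in H)%g = (g == fingroup.repr (H :* k)%g).
Proof.
rewrite /rcoset_rep -mem_rcoset; apply/andP/eqP => [[/eqP {2}-> /rcoset_eqP <-] //|->].
have /rcoset_eqP e := mem_repr_rcoset H k.
by rewrite e rcoset_refl.
Qed.

(** The dual bases are indexed by the whole group, with 0 at elements that are not chosen
    representatives, so that [gT] serves as the index type. *)
Definition skew_rep (g : gT) : RG := if rcoset_rep g then skew_term act 1 g else 0.
Definition skew_rep_inv (g : gT) : RG :=
  if rcoset_rep g then skew_term act 1 g^-1%g else 0.

Let skew_dual_l (a : RG) :
  \sum_g incl (skew_proj (a * skew_rep_inv g)) * skew_rep g = a.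
Proof.
(* At [k], only the representative of the coset H k contributes. *)
apply/ffunP => k; rewrite sum_ffunE (bigD1 (fingroup.repr (H :* k)%g)) //= big1 => [|g gk].
  have := rcoset_repE (fingroup.repr (H :* k)%g) k; rewrite eqxx => /andP[kr kH].
  rewrite /skew_rep_inv /skew_rep kr skew_mul_termr skew_incl_proj kH.
  by rewrite skew_mul_termr invgK mulgKV addr0.
rewrite /skew_rep_inv /skew_rep; case: ifPn => gr; last by rewrite mulr0 ffunE.
move: gk; rewrite -rcoset_repE gr /= => /negPf kH.
by rewrite skew_mul_termr skew_incl_proj kH.
Qed.

Let skew_dual_r (a : RG) :
  \sum_g skew_rep_inv g * incl (skew_proj (skew_rep g * a)) = a.
Proof.
(* The term of [g] contributes at [k] only if g k lies in [H], that is, if [g] represents the right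
   coset of the inverse of [k]. *)
apply/ffunP => k; rewrite sum_ffunE (bigD1 (fingroup.repr (H :* k^-1)%g)) //= big1 => [|g gk].
  have := rcoset_repE (fingroup.repr (H :* k^-1)%g) k^-1%g.
  rewrite eqxx -invMg groupV => /andP[kr kH].
  rewrite /skew_rep_inv /skew_rep kr skew_mul_terml skew_incl_proj invgK kH.
  by rewrite skew_mul_terml mulKg -ractM mulVg ract1 addr0.
rewrite /skew_rep_inv /skew_rep; case: ifPn => gr; last by rewrite mul0r ffunE.
move: gk; rewrite -rcoset_repE gr /= -invMg groupV => /negPf kH.
by rewrite skew_mul_terml skew_incl_proj invgK kH rmorph0.
Qed.

Definition skew_frobenius_system : frobenius_system incl :=
  FrobeniusSystem skew_projZl skew_projZr skew_dual_l skew_dual_r.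
End SkewFrobenius.

(** * Comparison of copure flat dimensions *)

Lemma cfd_mono (A B : pzRingType) (M : lmodType A) (N : lmodType B) :
  (forall n, cfd_le N n -> cfd_le M n) -> (cfd M <= cfd N)%E.
Proof.
move=> NM; rewrite /cfd; case: pselect => [exM|nM]; last first.
  case: pselect => // -[n nN]; case: nM; exists n.
  by apply/asboolP/NM/asboolP.
case: pselect => [exN|_]; last exact: leey.
rewrite lee_fin lez_nat.
case: (ex_minnP exN) => n /asboolP nN _; case: ex_minnP => m _; apply.
exact/asboolP/NM.
Qed.

Lemma cfD_mono (A B : pzRingType) :
  (forall M : lmodType A, exists N : lmodType B,
     forall n, cfd_le N n -> cfd_le M n) ->
  (cfD A <= cfD B)%E.
Proof.
move=> AB; have [_ minA] := cfD_supremum A; have [ubB _] := cfD_supremum B.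
apply: minA => _ [M ->]; have [N NM] := AB M.
by apply: le_trans (cfd_mono NM) _; apply: ubB; exists N.
Qed.

Theorem corollary7p3 (R : pzRingType) (gT : finGroupType)
    (act : ring_action gT R) (H : {group gT}) :
  (cfD (skew_group_ring (restrict_action act H))
     <= cfD (skew_group_ring act))%E /\
  (separable_extension (@skew_incl gT R act H) ->
   cfD (skew_group_ring (restrict_action act H)) = cfD (skew_group_ring act)).
Proof.
pose F := skew_frobenius_system act H.
have le_cfD : (cfD (skew_group_ring (restrict_action act H))
                 <= cfD (skew_group_ring act))%E.
  (* Each RH-module is compared with its coinduction; the form is normalized because the projection
     preserves 1. *)
  apply: cfD_mono => M; exists (coind (@skew_incl gT R act H) M) => n.
  exact: (cfd_le_coind (F := F) (skew_proj1 act H)).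
split=> // sep; apply/eqP; rewrite eq_le le_cfD /=.
(* For the reverse inequality, each RG-module is compared with its restriction. *)
apply: cfD_mono => N; exists (restr (@skew_incl gT R act H) N) => n.
exact: (cfd_le_restr F sep).
Qed.
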